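(* Let $b,r\ge1$ and let $S$ be a standard skew tableau with $b$ rows, each of size $r$. Let $w_1,\dots,w_b$ be the words formed by the entries of the rows of $S$, each read left to right, where $w_1$ is the bottom row and $w_b$ is the top row. For $i=1,\dots,b-1$ let $$c_i=(\text{length of the first row of } P(w_iw_{i+1}))-r,$$ where $w_iw_{i+1}$ is the concatenation. Then for every integer $k\ge b-1$, $\operatorname{Rect}(S^{(k)})$ has shape $(\lambda_1,\dots,\lambda_b)$ with $$\lambda_j=kr+\sum_{i=1}^{b-j}c_i-\sum_{i=1}^{j-1}c_i\qquad (j=1,\dots,b).$$
   Context: $P(w)$ denotes the Robinson–Schensted row-insertion tableau of a word $w$. Tableaux use English notation. $\operatorname{Rect}$ denotes jeu de taquin rectification. For a standard skew tableau $S$ with $m$ cells whose row lengths weakly decrease from top to bottom and $k\ge 1$, $S^{(k)}$ is the standard skew tableau obtained by attaching $k-1$ shifted copies of $S$ to the right of $S$: row $i$ of $S^{(k)}$ begins in the same column as row $i$ of $S$ and consists of the entries of row $i$ of $S$, followed by these entries plus $m$, followed by these entries plus $2m$, ..., followed by these entries plus $(k-1)m$. *)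

(* Defs.v *)
From mathcomp Require Import all_boot all_order all_algebra.
Set Implicit Arguments. Unset Strict Implicit. Unset Printing Implicit Defensive.

(* ---------- Skew tableaux ----------
   A skew tableau is given by its inner shape [mu] (mu_i = starting column of
   row i, rows indexed top to bottom from 0, English notation) and its rows
   [rows] (row i occupies columns mu_i, ..., mu_i + size row_i - 1).
   Entries are positive integers; the "filling function" returns 0 on cells
   that are not in the skew shape. *)

Definition tab_fun (mu : seq nat) (rows : seq (seq nat)) : nat -> nat -> nat :=
  fun i c =>
    let m := nth 0 mu i in
    let row := nth [::] rows i in
    if (m <= c) && (c < m + size row) then nth 0 row (c - m) else 0.

Definition is_skew_shape (mu : seq nat) (rows : seq (seq nat)) : Prop :=
  [/\ size mu = size rows,
      sorted geq mu &
      sorted geq [seq nth 0 mu i + size (nth [::] rows i) | i <- iota 0 (size rows)]].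

Definition standard_skew (mu : seq nat) (rows : seq (seq nat)) : Prop :=
  [/\ is_skew_shape mu rows,
      perm_eq (flatten rows) (iota 1 (size (flatten rows))),
      all (sorted ltn) rows &
      forall i c, tab_fun mu rows i c != 0 -> tab_fun mu rows i.+1 c != 0 ->
                  tab_fun mu rows i c < tab_fun mu rows i.+1 c].

(* S^(k): row i followed by its copies shifted by m, 2m, ..., (k-1)m,
   where m is the number of cells of S; same starting columns. *)
Definition power_rows (rows : seq (seq nat)) (k : nat) : seq (seq nat) :=
  let m := size (flatten rows) in
  [seq flatten [seq [seq x + q * m | x <- row] | q <- iota 0 k] | row <- rows].

Definition set2 (t : nat -> nat -> nat) (i j v : nat) : nat -> nat -> nat :=
  fun i' j' => if (i' == i) && (j' == j) then v else t i' j'.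

Fixpoint slide (fuel : nat) (t : nat -> nat -> nat) (i j : nat)
  : nat -> nat -> nat :=
  match fuel with
  | 0 => t
  | f.+1 =>
    let r := t i j.+1 in
    let d := t i.+1 j in
    if (r == 0) && (d == 0) then t
    else if (d == 0) || ((r != 0) && (r < d)) then
      slide f (set2 (set2 t i j r) i j.+1 0) i j.+1
    else
      slide f (set2 (set2 t i j d) i.+1 j 0) i.+1 j
  end.

(* Rectification: repeatedly slide into an inner corner (we always choose the
   inner corner in the lowest row having a nonempty inner part; by the
   fundamental theorem of jeu de taquin the result does not depend on the
   order).  [n] bounds the number of cells (fuel for each slide). *)
Fixpoint rect_aux (fuel n : nat) (mu : seq nat) (t : nat -> nat -> nat)
  : nat -> nat -> nat :=
  match fuel with
  | 0 => t
  | f.+1 =>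
    if has (fun x => 0 < x) mu then
      let i := (size mu).-1 - find (fun x => 0 < x) (rev mu) in
      let j := (nth 0 mu i).-1 in
      rect_aux f n (set_nth 0 mu i j) (slide n.+1 t i j)
    else t
  end.

Definition Rect (mu : seq nat) (rows : seq (seq nat)) : nat -> nat -> nat :=
  rect_aux (sumn mu) (size (flatten rows)) mu (tab_fun mu rows).

Definition bump (row : seq nat) (x : nat) : option nat * seq nat :=
  let p := find (fun y => x < y) row in
  if p < size row then (Some (nth 0 row p), set_nth 0 row p x)
  else (None, rcons row x).

Fixpoint rs_insert (P : seq (seq nat)) (x : nat) : seq (seq nat) :=
  match P with
  | [::] => [:: [:: x]]
  | row :: rest =>
    match bump row x with
    | (None, row') => row' :: rest
    | (Some y, row') => row' :: rs_insert rest y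
    end
  end.

Definition RS_P (w : seq nat) : seq (seq nat) := foldl rs_insert [::] w.

Definition first_row_length (P : seq (seq nat)) : nat := size (head [::] P).

(* Main.v *)
Require Import Defs.
From mathcomp Require Import all_boot all_order all_algebra.
From mathcomp Require Import zify.
Set Implicit Arguments. Unset Strict Implicit. Unset Printing Implicit Defensive.

(** A standard skew tableau is a chain of shapes, one cell per entry.  Sliding
    into all the inner cells of one row moves an entry up by one row exactly when
    the two shape chains, before and after, would otherwise stop differing by a
    horizontal strip; hence the numbers of moved entries satisfy a max-plus
    recursion, which only involves the functions
    D_i(t) = #{x <= t in w_i} - #{x <= t in w_(i+1)}.
    These are periodic on the power tableau, with maximum c_i.
    Numbering rows from the bottom, in the phase which inserts row j+1 at most
    c_(j-i+1) + ... + c_j entries move from row i to row i+1, by induction on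
    phases; the bound is attained because D_i reaches c_i once in each copy of S,
    and b-1 copies suffice for all the maxima to be met in the order in which the
    recursion needs them. *)

(** * Shape chains and a single jeu de taquin slide *)

(* [s x p] is the end column of row [p] of the shape occupied by the inner cells
   and the entries at most [x]; [y x] is the row of the entry [x.+1]. *)
Definition growth (M : nat) (s : nat -> nat -> nat) (y : nat -> nat) : Prop :=
  (forall x p, x <= M -> s x p.+1 <= s x p) /\
  (forall x p, x < M -> s x.+1 p = s x p + (p == y x)).

Definition fills (M : nat) (s t : nat -> nat -> nat) : Prop :=
  (forall i c, t i c <= M) /\
  (forall i c x, x < M -> (t i c == x.+1) = (s x i <= c < s x.+1 i)).

(** The entry [x.+1] lies directly under the hole, which is at column [(s x h).-1] of row [h]; only
    then does the hole change rows. *)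
Definition drops (s : nat -> nat -> nat) (y : nat -> nat) (x h : nat) : bool :=
  (y x == h.+1) && ((s x h.+1).+1 == s x h).

(* The hole of the slide, seen in the subtableau of the entries at most [x], lies
   in row [hole s y i0 x], at its last cell. *)
Fixpoint hole (s : nat -> nat -> nat) (y : nat -> nat) (i0 x : nat) : nat :=
  if x is x'.+1 then
    let h := hole s y i0 x' in if drops s y x' h then h.+1 else h
  else i0.

Definition slide_chain (s : nat -> nat -> nat) (y : nat -> nat) (i0 : nat) :=
  fun x p => s x p - (p == hole s y i0 x).

Definition slide_row (s : nat -> nat -> nat) (y : nat -> nat) (i0 : nat) :=
  fun x => let h := hole s y i0 x in if drops s y x h then h else y x.

(** Only an entry added to the next row could stop the hole from being a corner, and only if placed
    right under it. The hole then drops to the end of that longer row and is a corner there. *)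
Lemma hole_corner M s y i0 x :
  growth M s y -> s 0 i0.+1 < s 0 i0 -> x <= M ->
  s x (hole s y i0 x).+1 < s x (hole s y i0 x).
Proof.
move=> [Hp Hy] H0; elim: x => [//|x IH] Hx /=.
have := IH (ltnW Hx); have Hp1 := Hp x.+1; move: Hp1.
set h := hole s y i0 x => Hp1.
case: ifP; rewrite /drops.
- move=> /andP [/eqP Hyx /eqP E] _.
  have := Hp x h.+1 (ltnW Hx); rewrite !(Hy x) // Hyx; lia.
- rewrite !(Hy x) //; case: (eqVneq (y x) h.+1) => [->|] /=; lia.
Qed.

Lemma slide_growth M s y i0 :
  growth M s y -> s 0 i0.+1 < s 0 i0 ->
  growth M (slide_chain s y i0) (slide_row s y i0).
Proof.
move=> G H0; have [Hp Hy] := G; split=> [x p Hx|x p Hx].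
- have := hole_corner G H0 Hx; have := Hp x p Hx; rewrite /slide_chain.
  case: (eqVneq p (hole s y i0 x)) => [<-|]; lia.
- have := hole_corner G H0 (ltnW Hx); rewrite /slide_chain /slide_row /= /drops.
  set h := hole s y i0 x => Hh; rewrite (Hy x) //.
  case: (eqVneq (y x) h.+1) => [->|] /=; last first.
    case: (eqVneq p h) => [->|]; lia.
  case: (eqVneq (s x h.+1).+1 (s x h)) => [E|NE] /=.
    case: (eqVneq p h) => [->|]; first lia.
    case: (eqVneq p h.+1) => [->|]; lia.
  case: (eqVneq p h) => [->|]; first lia.
  case: (eqVneq p h.+1) => [->|]; lia.
Qed.

(* When the hole has passed the entries at most [x], these already follow the slid
   chain, while the larger ones still follow the original chain. *)
Lemma slide_fills_from M s y i0 f x t :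
  growth M s y -> s 0 i0.+1 < s 0 i0 -> x <= M -> M - x < f ->
  (forall i c, t i c <= M) ->
  (forall i c v, v < M -> (t i c == v.+1) =
     if v < x then slide_chain s y i0 v i <= c < slide_chain s y i0 v.+1 i
     else s v i <= c < s v.+1 i) ->
  fills M (slide_chain s y i0)
    (slide f t (hole s y i0 x) (s x (hole s y i0 x)).-1).
Proof.
move=> G H0; have [Hp Hy] := G; have [Hp' Hy'] := slide_growth G H0.
set s' := slide_chain s y i0 in Hp' Hy' *.
have mono' a p v : a <= v -> v <= M -> s' a p <= s' v p.
  elim: v => [|v IHv]; first by rewrite leqn0 => /eqP->.
  rewrite leq_eqVlt => /orP [/eqP->//|Hav] Hv; rewrite Hy' //.
  by have := IHv Hav (ltnW Hv); lia.
move Em : (M - x) => n; elim: n x Em f t => [|n IH] x Em f t Hx Hf Ht Hv.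
(* All entries have been passed, so both neighbours of the hole are empty and the slide stops. *)
- have Ex : x = M by lia.
  subst x; case: f Hf => // f _ /=.
  have Hc := hole_corner G H0 (leqnn M).
  set h := hole s y i0 M in Hc *.
  have E0 i c : s' M i <= c -> t i c == 0.
    move=> Hic; case E: (t i c) => [//|v].
    have vM : v < M by have := Ht i c; lia.
    have := Hv i c v vM; rewrite E eqxx vM => /esym.
    have := mono' v.+1 i M vM (leqnn _); lia.
  have Eh : s' M h = (s M h).-1 by rewrite /s' /slide_chain -/h eqxx subn1.
  have Er : t h (s M h).-1.+1 == 0 by apply: E0; lia.
  have Ed : t h.+1 (s M h).-1 == 0.
    by apply: E0; have := Hp' M h (leqnn _); lia.
  rewrite Er Ed /=; split=> // i c v vM; by rewrite Hv // vM.
- have xM : x < M by lia.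
  have Hc := hole_corner G H0 Hx.
  have IHx := IH x.+1 _ _ _ xM; move: IHx => /=.
  set h := hole s y i0 x in Hc *.
  have Eh : s' x h = (s x h).-1 by rewrite /s' /slide_chain -/h eqxx subn1.
  have Eq p : p != h -> s' x p = s x p.
    by move=> /negPf Hph; rewrite /s' /slide_chain -/h Hph subn0.
  have far i c v : s' x i <= c -> v < x -> t i c == v.+1 = false.
    move=> Hic vx; rewrite Hv ?vx; last by lia.
    have := mono' v.+1 i x vx Hx; lia.
  (* After a move only the cells of [x.+1] need checking, provided every other entry stays where it
     was. *)
  have step i c v t' : v < M -> 
      (forall v, v < M -> v != x -> (t' i c == v.+1) = (t i c == v.+1)) ->
      (t' i c == x.+1) = (s' x i <= c < s' x.+1 i) ->
      (t' i c == v.+1) = if v < x.+1 then s' v i <= c < s' v.+1 i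
                         else s v i <= c < s v.+1 i.
    move=> vM H1 H2; case: (ltngtP v x) => [vx|vx|->].
    - by rewrite ltnS ltnW // H1 ?(ltn_eqF vx) // Hv // vx.
    - by rewrite ltnS leqNgt vx /= H1 ?(gtn_eqF vx) // Hv // ltnNge ltnW.
    - by rewrite ltnSn.
  have Ed0 : s' x h.+1 = s x h.+1 by rewrite Eq //; lia.
  have Hyx p := Hy x p xM.
  have Hyx' p := Hy' x p xM; rewrite /slide_row -/h in Hyx'.
  have Hvx i c : (t i c == x.+1) = (s x i <= c < s x.+1 i).
    by rewrite Hv // ltnn.
  have big i c : s' x i <= c -> t i c != 0 -> x < t i c.
    move=> Hic; case E: (t i c) => [//|v] _; rewrite ltnS leqNgt.
    by apply/negP => vx; have := far i c v Hic vx; rewrite E eqxx.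
  set j := (s x h).-1 in Eh *.
  have Ej : s x h = j.+1 by rewrite /j; lia.
  have monoh v : x <= v -> v <= M -> s x h <= s v h.
    elim: v => [|v IHv]; first by rewrite leqn0 => /eqP->.
    rewrite leq_eqVlt => /orP [/eqP<-//|Hav] Hvm; rewrite Hy //.
    by have := IHv Hav (ltnW Hvm); lia.
  have empty v : v < M -> (t h j == v.+1) = false.
    move=> vM; case: (ltnP v x) => vx; first by rewrite far ?Eh.
    by rewrite Hv // ltnNge vx /=; have := monoh v vx (ltnW vM); lia.
  (* If the hole drops, [x.+1] is just below it, and the right neighbour of the hole is empty or
     larger: the slide goes down. *)
  case Edr: (drops s y x h).
    have /andP[/eqP Ey /eqP Es] := Edr.
    rewrite Edr in Hyx'.
    have Ed : t h.+1 j = x.+1.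
      by apply/eqP; rewrite Hvx Hyx Ey eqxx; lia.
    have Er : (t h j.+1 == 0) || (x.+1 < t h j.+1).
      case: eqVneq => //= N0; have := big h j.+1; rewrite Eh => /(_ _ N0) Hb.
      rewrite ltn_neqAle eq_sym Hvx Hyx Ey; lia.
    case: f Hf => [//|f] Hf /=; rewrite Ed andbF /=.
    have -> : (t h j.+1 != 0) && (t h j.+1 < x.+1) = false by lia.
    have -> : j = (s x.+1 h.+1).-1 by rewrite Hyx Ey eqxx; lia.
    move=> IHx; have Ej' : (s x.+1 h.+1).-1 = j by rewrite Hyx Ey eqxx; lia.
    apply: IHx; rewrite ?Ej'; [lia|lia| |].
    - by move=> i c; rewrite /set2; case: ifP => // _; case: ifP.
    - move=> i c v vM; apply: step => //.
      + move=> v' vM' vx'; rewrite /set2.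
        case: ifP => [/andP[/eqP-> /eqP->]|_]; first by rewrite Ed; lia.
        case: ifP => [/andP[/eqP-> /eqP->]|//]; by rewrite empty //; lia.
      + rewrite Hyx' /set2; case: ifP => [/andP[/eqP-> /eqP->]|N1].
          by case: eqVneq => [|_]; lia.
        case: ifP => [/andP[/eqP-> /eqP->]|N2]; first by rewrite !eqxx Eh; lia.
        rewrite Hvx Hyx Ey; move: N1 N2.
        case: (eqVneq i h.+1) => [->|Ni] /=; first by rewrite Ed0; lia.
        case: (eqVneq i h) => [->|Ni'] /=; first by rewrite Eh; lia.
        lia.
  rewrite Edr in Hyx'.
  have Edr' : y x = h.+1 -> (s x h.+1).+1 != s x h.
    by move=> Ey; move: Edr; rewrite /drops Ey eqxx => /negbT.
  (* If [x.+1] is neither below nor to the right of the hole, [slide] takes no step: [x] advances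
     and no fuel is spent. *)
  case: (eqVneq (y x) h) => [Ey|Ny]; last first.
    have Ej' : (s x.+1 h).-1 = j by rewrite Hyx; lia.
    move=> IHx; rewrite -Ej'; apply: IHx => //; [lia|lia|].
    move=> i c v vM; apply: step => //.
    rewrite Hvx Hyx Hyx'; case: (eqVneq i h) => [->|Ni]; last by rewrite Eq.
    by lia.
  (* Here [x.+1] is the right neighbour of the hole, and the cell below is empty or larger. *)
  have Er : t h j.+1 = x.+1.
    by apply/eqP; rewrite Hvx Hyx Ey eqxx; lia.
  have Ed : (t h.+1 j == 0) || (x.+1 < t h.+1 j).
    case: eqVneq => //= N0; have := big h.+1 j; rewrite Ed0 => /(_ _ N0) Hb.
    rewrite ltn_neqAle eq_sym Hvx Hyx Ey; lia.
  case: f Hf => [//|f] Hf /=; rewrite Er /=.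
  have -> : (t h.+1 j == 0) || (x.+1 < t h.+1 j) = true by [].
  move=> IHx; have Ej' : (s x.+1 h).-1 = j.+1 by rewrite Hyx Ey eqxx; lia.
  rewrite Ej' in IHx.
  apply: IHx; [lia|lia| |].
  - by move=> i c; rewrite /set2; case: ifP => // _; case: ifP.
  - move=> i c v vM; apply: step => //.
    + move=> v' vM' vx'; rewrite /set2.
      case: ifP => [/andP[/eqP-> /eqP->]|_]; first by rewrite Er; lia.
      case: ifP => [/andP[/eqP-> /eqP->]|//]; by rewrite empty //; lia.
    + rewrite Hyx' /set2; case: ifP => [/andP[/eqP-> /eqP->]|N1].
        by rewrite Ey Eh; lia.
      case: ifP => [/andP[/eqP-> /eqP->]|N2]; first by rewrite Ey !eqxx Eh; lia.
      rewrite Hvx Hyx Ey; move: N1 N2.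
      case: (eqVneq i h) => [->|Ni'] /=; first by rewrite Eh; lia.
      by rewrite Eq //; lia.
Qed.

Lemma slide_fills M s y i0 f t :
  growth M s y -> s 0 i0.+1 < s 0 i0 -> M < f -> fills M s t ->
  fills M (slide_chain s y i0) (slide f t i0 (s 0 i0).-1).
Proof.
move=> G H0 Hf [Ht1 Ht2].
by apply: (slide_fills_from (x := 0) G H0) => //; rewrite subn0.
Qed.

Lemma fills_neq0 M s y t i c :
  growth M s y -> fills M s t -> (t i c != 0) = (s 0 i <= c < s M i).
Proof.
move=> [_ Hy] [Ht1 Ht2].
have key v : v <= M -> (0 < t i c <= v) = (s 0 i <= c < s v i).
  elim: v => [|v IH] Hv; first by lia.
  have := IH (ltnW Hv); have := Ht2 i c v Hv; have := Hy v i Hv.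
  have : v <= M -> s 0 i <= s v i; last by move=> /(_ (ltnW Hv)); lia.
  elim: (v) => [//|w IHw] Hw; rewrite Hy //; have := IHw (ltnW Hw); lia.
by rewrite -key // Ht1 andbT lt0n.
Qed.

(** * Horizontal strips between two chains *)

(** The first two clauses say that [t x] arises from [s x] by deleting a horizontal strip. The third
    is a local rule: an entry goes up a row exactly when keeping its row would break the second
    clause, and no entry goes above row [i0]. *)
Definition strip (M i0 : nat) (s : nat -> nat -> nat) (y : nat -> nat)
    (t : nat -> nat -> nat) (yt : nat -> nat) : Prop :=
  [/\ forall x p, x <= M -> t x p <= s x p,
      forall x p, x <= M -> s x p.+1 <= t x p &
      forall x, x < M ->
        yt x = if (i0 < y x) && (s x (y x) == t x (y x).-1)
               then (y x).-1 else y x].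

Lemma strip_refl M i0 s y : growth M s y -> strip M i0 s y s y.
Proof.
move=> [Hp Hy]; split=> // x Hx; case: ifP => // /andP[Hi /eqP E].
have := Hp x.+1 (y x).-1 Hx; rewrite !Hy // prednK ?eqxx; lia.
Qed.

(** Below the row of the hole [t] still agrees with [s], and the hole lies beyond the next row of
    [s], so deleting it keeps the interlacing. The local rule newly fires exactly for the entries
    under which the hole drops. *)
Lemma strip_slide M i0 s y t yt :
  growth M s y -> growth M t yt -> strip M i0 s y t yt ->
  (forall p, i0 < p -> s 0 p = 0) -> 0 < t 0 i0 ->
  strip M i0 s y (slide_chain t yt i0) (slide_row t yt i0).
Proof.
move=> [Hp Hy] [Hpt Hyt] [Hle Hint Hrule] H0 Ht0.
set h := hole t yt i0.
(* The holes of the earlier slides stay in rows at most that of the new hole. *)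
pose inv x := [/\ i0 <= h x, forall p, h x < p -> t x p = s x p &
                  s x (h x).+1 < t x (h x)].
have stepP x : x < M -> inv x ->
    slide_row t yt i0 x =
      (if (i0 < y x) && (s x (y x) == slide_chain t yt i0 x (y x).-1)
       then (y x).-1 else y x) /\ inv x.+1.
  move=> Hx [Hi J K]; have Hx' := ltnW Hx.
  have Ryt := Hrule x Hx; rewrite /slide_row /slide_chain /inv /= /drops.
  rewrite -/(h x) in J K *; rewrite !Hy // !Hyt //.
  have -> : h x.+1 = if drops t yt x (h x) then (h x).+1 else h x by [].
  rewrite /drops.
  move: Hi J K; move: (h x) => q Hi J K.
  (* If the rule already fires for [t], the entry lands strictly above the row [q] of the hole, so
     the new slide leaves it alone. *)
  case: ifP Ryt => [/andP[Hiy /eqP E] Ryt|Nc Ryt].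
    have [i Ei] : exists i, y x = i.+1 by exists (y x).-1; lia.
    rewrite Ei /= in E Ryt Hiy *; rewrite Ryt Hiy /=.
    have P1 := Hp x.+1 i Hx; rewrite !Hy // Ei in P1.
    have qi : i < q.
      rewrite ltnNge; apply/negP; rewrite leq_eqVlt => /orP[/eqP Eq|Hq].
        by move: K; rewrite Eq; lia.
      by have := J i Hq; lia.
    have -> : (i == q.+1) = false by lia.
    have -> : (i == q) = false by lia.
    rewrite /= subn0 E eqxx; split=> //; split=> //; last by lia.
    move=> p Hqp; rewrite Hyt // Hy // J // Ryt Ei; lia.
  rewrite Ryt; case: ifP => [/andP[/eqP Ey /eqP Es]|Nd].
    rewrite Ey eqxx /= ltnS Hi eqxx /= subn1 -Es /= J // eqxx /=; split=> //.
    split; first by lia.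
      move=> p Hqp; rewrite Hyt //. rewrite Hy // J; lia.
    by have := Hp x q.+1 Hx'; lia.
  split.
    case: ifP => // /andP[Hiy]; case: (eqVneq (y x).-1 q) => [Eq|Nq]; last first.
      by rewrite subn0 => E; rewrite Hiy E in Nc.
    have Ey : y x = q.+1 by lia.
    rewrite Ey subn1 /= => /eqP E; move: Nd; rewrite Ey eqxx J ?E //; lia.
  split=> //; first by move=> p Hqp; rewrite Hyt // Hy // J // Ryt.
  case: (eqVneq (y x) q.+1) => [Ey|Ny]; last by lia.
  by move: Nd; rewrite Ey eqxx J //; lia.
have invP x : x <= M -> inv x.
  elim: x => [|x IH] Hx; last by have [] := stepP x Hx (IH (ltnW Hx)).
  split=> //= [p Hp0|]; last by rewrite H0.
  by have := Hle 0 p Hx; have := H0 p Hp0; lia.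
split=> [x p Hx|x p Hx|x Hx].
- by have := Hle x p Hx; rewrite /slide_chain; lia.
- have [_ _ K] := invP x Hx; have := Hint x p Hx; rewrite /slide_chain -/(h x).
  by case: (eqVneq p (h x)) => [->|]; lia.
- by have [] := stepP x Hx (invP x (ltnW Hx)).
Qed.

(** * Rectification in phases, one per row, from the bottom up *)

Definition slide_pair (i0 : nat) (g : (nat -> nat -> nat) * (nat -> nat)) :=
  (slide_chain g.1 g.2 i0, slide_row g.1 g.2 i0).

Lemma find_last_pos mu i0 :
  0 < nth 0 mu i0 -> (forall p, i0 < p -> nth 0 mu p = 0) ->
  has (fun x => 0 < x) mu /\
  (size mu).-1 - find (fun x => 0 < x) (rev mu) = i0.
Proof.
move=> Hi Hz.
have Hs : i0 < size mu by rewrite ltnNge; apply: contraTN Hi => /(nth_default 0)->.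
have Hh : has (fun x => 0 < x) mu.
  by apply/hasP; exists (nth 0 mu i0) => //; apply: mem_nth.
split=> //; have Hr : has (fun x => 0 < x) (rev mu) by rewrite has_rev.
have := nth_find 0 Hr; have := @before_find _ 0 (fun x => 0 < x) (rev mu).
have := Hr; rewrite has_find size_rev; move: (find _ _) => q Hf Hb.
rewrite nth_rev // => Hn.
have H1 : size mu - q.+1 <= i0.
  by rewrite leqNgt; apply/negP => /Hz E; rewrite E in Hn.
have H2 : q <= (size mu).-1 - i0.
  rewrite leqNgt; apply/negP => /Hb.
  rewrite nth_rev; last by lia.
  by have -> : size mu - ((size mu).-1 - i0).+1 = i0; lia.
lia.
Qed.

(** The inner cells of row [i0] are filled from right to left. By [strip_slide], all these slides
    together still amount to one horizontal strip. *)
Lemma rect_aux_phase M i0 g mu t r :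
  growth M g.1 g.2 -> fills M g.1 t -> i0 < size mu ->
  (forall p, g.1 0 p = nth 0 mu p) ->
  (forall p, i0 < p -> nth 0 mu p = 0) -> r <= nth 0 mu i0 ->
  let g' := iter r (slide_pair i0) g in
  let mu' := set_nth 0 mu i0 (nth 0 mu i0 - r) in
  [/\ growth M g'.1 g'.2, strip M i0 g.1 g.2 g'.1 g'.2,
      forall p, g'.1 0 p = nth 0 mu' p &
      exists2 t', fills M g'.1 t' &
        forall f, rect_aux (r + f) M mu t = rect_aux f M mu' t'].
Proof.
move=> G F Hs Emu Hz; elim: r => [|r IH] Hr /=.
  have E : set_nth 0 mu i0 (nth 0 mu i0 - 0) = mu.
    apply: (@eq_from_nth _ 0) => [|p _]; first by rewrite size_set_nth; lia.
    by rewrite subn0 nth_set_nth /=; case: eqP => [->|].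
  by rewrite E; split=> //; [apply: strip_refl|exists t].
have [G1 S1 E1 [t1 F1 R1]] := IH (ltnW Hr).
set g1 := iter r _ g in G1 S1 E1 F1 *.
set mu1 := set_nth 0 mu i0 (nth 0 mu i0 - r) in E1 R1.
have Emu1 p : nth 0 mu1 p = if p == i0 then nth 0 mu i0 - r else nth 0 mu p.
  by rewrite nth_set_nth.
have H1 : g1.1 0 i0 = nth 0 mu i0 - r by rewrite E1 Emu1 eqxx.
have H2 p : i0 < p -> g1.1 0 p = 0.
  by move=> Hp; rewrite E1 Emu1 gtn_eqF ?Hz.
have Hc : g1.1 0 i0.+1 < g1.1 0 i0 by rewrite H1 H2 //; lia.
have Emu2 : set_nth 0 mu1 i0 (nth 0 mu1 i0).-1
          = set_nth 0 mu i0 (nth 0 mu i0 - r.+1).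
  by rewrite set_set_nth eqxx Emu1 eqxx; congr set_nth; lia.
split.
- exact: slide_growth.
- by apply: strip_slide => //; [move=> p Hp; rewrite Emu Hz|rewrite H1; lia].
- move=> p; rewrite -Emu2 /slide_chain /= E1 nth_set_nth /=.
  by case: (eqVneq p i0) => [->|]; lia.
- exists (slide M.+1 t1 i0 (g1.1 0 i0).-1); first exact: slide_fills.
  move=> f; rewrite -[LHS]/(rect_aux (r.+1 + f) M mu t) addSnnS R1 /=.
  have P1 : 0 < nth 0 mu1 i0 by rewrite Emu1 eqxx; lia.
  have [|-> ->] := find_last_pos P1; last by rewrite Emu2 H1 Emu1 eqxx.
  by move=> p Hp; rewrite Emu1 gtn_eqF ?Hz.
Qed.

(** The number of slides can be read off the original [mu], because earlier phases keep the inner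
    cells of higher rows. *)
Fixpoint phases (mu : seq nat) (g : (nat -> nat -> nat) * (nat -> nat)) (j : nat) :=
  if j is j'.+1 then
    let i0 := size mu - j in
    iter (nth 0 mu i0) (slide_pair i0) (phases mu g j')
  else g.

Lemma rect_aux_phases M g mu t j :
  growth M g.1 g.2 -> fills M g.1 t -> (forall p, g.1 0 p = nth 0 mu p) ->
  j <= size mu ->
  let g' := phases mu g j in
  let mu' := take (size mu - j) mu ++ nseq j 0 in
  [/\ growth M g'.1 g'.2,
      forall p, g'.1 0 p = nth 0 mu' p,
      forall i, j = i.+1 ->
        let g1 := phases mu g i in strip M (size mu - j) g1.1 g1.2 g'.1 g'.2 &
      exists2 t', fills M g'.1 t' &
        rect_aux (sumn mu) M mu t = rect_aux (sumn mu') M mu' t'].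
Proof.
move=> G F Emu; elim: j => [|j IH] Hj.
  by rewrite /= subn0 take_size cats0; split=> //; exists t.
have [G1 E1 _ [t1 F1 R1]] := IH (ltnW Hj).
rewrite /=; set i0 := size mu - j.+1.
set mu1 := take (size mu - j) mu ++ nseq j 0 in E1 R1.
have Ei0 : size mu - j = i0.+1 by rewrite /i0; lia.
have Hi0 : i0 < size mu by rewrite /i0; lia.
have Emu1 : mu1 = take i0 mu ++ nth 0 mu i0 :: nseq j 0.
  by rewrite /mu1 Ei0 (take_nth 0) // cat_rcons.
have St : size (take i0 mu) = i0 by rewrite size_take Hi0.
have Hn : nth 0 mu1 i0 = nth 0 mu i0 by rewrite Emu1 nth_cat St ltnn subnn.
have [] := @rect_aux_phase M i0 _ mu1 t1 (nth 0 mu i0) G1 F1.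
- by rewrite Emu1 size_cat /= St; lia.
- by [].
- move=> p Hp; rewrite Emu1 nth_cat St ltnNge ltnW //=.
  have -> : p - i0 = (p - i0.+1).+1 by lia.
  by rewrite /= nth_nseq; case: ifP.
- by rewrite Hn.
rewrite Hn subnn; set g2 := iter _ _ _; move=> G2 S2 E2 [t2 F2 R2].
have Emu2 : set_nth 0 mu1 i0 0 = take i0 mu ++ 0 :: nseq j 0.
  apply: (@eq_from_nth _ 0) => [|p _].
    rewrite size_set_nth Emu1 !size_cat /= St; lia.
  rewrite nth_set_nth Emu1 /= !nth_cat St.
  case: (ltngtP p i0) => // [Hp|->]; last by rewrite subnn.
  by have -> : p - i0 = (p - i0.+1).+1 by lia.
rewrite Emu2 in E2 R2; split=> //; [by move=> _ [<-]|exists t2 => //].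
by rewrite R1 -R2; congr rect_aux; rewrite Emu1 !sumn_cat /=; lia.
Qed.

(** * The max-plus recursion and its saturation *)

(* Rows are numbered from the bottom, starting at 1: [N i t] and [N' i t] count the
   entries at most [t] in row [i] before and after the phase which inserts row
   [j.+1], and [u i t] counts those which that phase moves from row [i] to [i.+1]. *)
Definition raises (b T j : nat) (N N' u : nat -> nat -> nat) : Prop :=
  [/\ forall i t, t <= T -> (i == 0) || (j < i) -> u i t = 0,
      forall i t, t <= T -> 0 < i <= b -> N' i t + u i t = N i t + u i.-1 t,
      forall i, u i 0 = 0,
      forall i t, t <= T -> 0 < i <= j -> N i t <= N' i.+1 t &
      forall i t, t < T -> 0 < i <= j ->
        u i t.+1 = u i t \/ u i t < u i t.+1 /\ N i t.+1 = N' i.+1 t.+1].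

(** From this time on [u i] has its final value. It is a peak of D_i, delayed by [j - i] copies of S
    so that row [i.+1] is saturated first. *)
Definition sat_time (m : nat) (e : nat -> nat) (j i : nat) := e i + m * (j - i).

(* [C j] stands for c_1 + ... + c_j, and [N0] for the row contents of the skew
   tableau; the second clause compares row [i] before the phase with row [i.+1]
   after it. *)
Definition rect_inv (b T m : nat) (N0 : nat -> nat -> nat) (C e : nat -> nat)
    (j : nat) (N u : nat -> nat -> nat) : Prop :=
  let th := sat_time m e in
  [/\ (forall t, t <= T -> u 0 t = 0) /\
      (forall i t, t < T -> i <= j -> u i t <= u i t.+1),
      forall i t, t <= T -> 0 < i <= j -> N i t + u i t <= N i.+1 t + u i.-1 t,
      (forall i t, t <= T -> j.+1 < i <= b -> N i t = N0 i t) /\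
      (forall t, t <= T -> N j.+1 t = N0 j.+1 t + u j t),
      forall i t, t <= T -> i <= j ->
        u i t + C (j - i) <= C j /\
        (th j i <= t -> u i t + C (j - i) = C j) &
      forall i t, t <= T -> 0 < i <= j.+1 ->
        (i <= j -> th j i <= t) -> (1 < i -> th j i.-1 <= t) ->
        N i t + C (j.+1 - i) = N0 i t + C i.-1].

(** Upper bound: whenever [u' i] rises, the old row [i] is level with the new row [i.+1], which
    expresses [u' i] through [u' i.+1]. Attainment: at a peak of D_i interlacing alone gives the
    reverse inequality, once row [i.+1] and the previous phase are saturated. *)
Lemma rect_inv_step b T m N0 C c e j N N' u u' :
  (forall i, C i.+1 = C i + c i.+1) -> C 0 = 0 ->
  (forall i, 0 < i -> i.+1 < b -> e i <= e i.+1 <= e i + m) ->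
  (forall i q, 0 < i < b -> e i + m * q <= T ->
     N0 i (e i + m * q) = N0 i.+1 (e i + m * q) + c i) ->
  (forall i t, t <= T -> 0 < i < b -> N0 i t <= N0 i.+1 t + c i) ->
  j.+1 < b ->
  rect_inv b T m N0 C e j N u -> raises b T j.+1 N N' u' ->
  rect_inv b T m N0 C e j.+1 N' u'.
Proof.
move=> HC C0 He Heq Hle jb [[U0 U1] I1 [I2 I2'] Isat IN] [Z Cons U00 P4 P5].
have mono i t t' : 0 < i <= j.+1 -> t <= t' -> t' <= T -> u' i t <= u' i t'.
  move=> Hi; elim: t' => [|t' IH]; first by rewrite leqn0 => /eqP->.
  rewrite leq_eqVlt => /orP[/eqP->//|Ht] HT.
  by have := IH Ht (ltnW HT); case: (P5 i t' HT Hi) => [->|[? _]] //; lia.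
(* Induction from the top moved row downwards and, within a row, over time; the second clause of
   [rect_inv] absorbs the change of row. *)
have Uinc i t : t <= T -> i <= j -> u' i.+1 t <= u i t + c j.+1.
  move En : (j - i) => n; elim: n i En t => [|n IH] i En t HT Hi.
    have Ei : i = j by lia.
    rewrite Ei; elim: t HT => [|t IHt] HT; first by rewrite U00.
    have Mu := U1 j t HT (leqnn _).
    have [->|[_ E]] := P5 j.+1 t HT (leqnn _).
      by have := IHt (ltnW HT); lia.
    have Q := Cons j.+2 t.+1 HT jb; rewrite /= [u' j.+2 _]Z ?ltnSn ?orbT // in Q.
    have R : N j.+2 t.+1 = N0 j.+2 t.+1 by apply: I2 => //; rewrite ltnSn.
    have D : N0 j.+1 t.+1 <= N0 j.+2 t.+1 + c j.+1 by apply: Hle.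
    by have := I2' _ HT; lia.
  elim: t HT => [|t IHt] HT; first by rewrite U00.
  have Mu : u i t <= u i t.+1 by apply: U1; lia.
  have [->|[_ E]] := P5 i.+1 t HT Hi.
    by have := IHt (ltnW HT); lia.
  have Q : N' i.+2 t.+1 + u' i.+2 t.+1 = N i.+2 t.+1 + u' i.+1 t.+1.
    by apply: Cons => //; lia.
  have V : u' i.+2 t.+1 <= u i.+1 t.+1 + c j.+1 by apply: IH => //; lia.
  have := I1 i.+1 _ HT; rewrite /=; lia.
have Ubd i t : t <= T -> i <= j.+1 -> u' i t + C (j.+1 - i) <= C j.+1.
  case: i => [|i] HT Hi; first by rewrite Z // subn0.
  by have := Uinc i t HT Hi; have [] := Isat i t HT Hi; rewrite subSS HC; lia.
(* The bounds [e i <= e i.+1 <= e i + m] order the saturation times as the induction needs: previous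
   phase first, then row [i.+1] before row [i]. *)
have th_le i : 0 < i <= j -> sat_time m e j i <= sat_time m e j.+1 i.
  by move=> Hi; rewrite /sat_time leq_add2l leq_mul2l; lia.
have th_up i : 0 < i <= j -> sat_time m e j i <= sat_time m e j.+1 i.+1.
  move=> Hi; have /andP[H1 _] : e i <= e i.+1 <= e i + m by apply: He; lia.
  by rewrite /sat_time subSS leq_add2r.
have th_down i : 0 < i <= j -> sat_time m e j.+1 i.+1 <= sat_time m e j.+1 i.
  move=> Hi; have /andP[_ H1] : e i <= e i.+1 <= e i + m by apply: He; lia.
  rewrite /sat_time subSS subSn ?mulnS; lia.
have Usat i t : t <= T -> i <= j.+1 -> sat_time m e j.+1 i <= t ->
    u' i t + C (j.+1 - i) = C j.+1.
  move En : (j.+1 - i) => n; elim: n i En t => [|n IH] i En t HT Hi Ht.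
    have Ei : i = j.+1 by lia.
    subst i; set s := sat_time m e j.+1 j.+1 in Ht.
    have HsT : s <= T by lia.
    have M1 := mono j.+1 s t (leqnn _) Ht HT.
    have := Ubd j.+1 t HT (leqnn _); rewrite subnn C0.
    have P := P4 j.+1 s HsT (leqnn _).
    have Q := Cons j.+2 s HsT jb; rewrite /= Z ?ltnSn ?orbT // in Q.
    have R : N j.+2 s = N0 j.+2 s by apply: I2 => //; rewrite ltnSn.
    have D : N0 j.+1 s = N0 j.+2 s + c j.+1.
      by apply: (Heq j.+1 (j.+1 - j.+1) _ HsT); lia.
    have E : u j s = C j.
      case: (posnP j) => [->|Hj]; first by rewrite U0 // C0.
      have [_ ] := Isat j s HsT (leqnn _); rewrite subnn C0 addn0; apply.
      by apply: th_up; lia.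
    have := I2' s HsT; rewrite HC; lia.
  case: (posnP i) => [Hi0|Hi0]; first by move: En; rewrite Hi0 subn0 Z // => ->.
  have Hij : 0 < i <= j by lia.
  (* It suffices to reach the bound at the saturation time, since [u' i] is monotone and never
     exceeds it. *)
  set s := sat_time m e j.+1 i in Ht.
  have HsT : s <= T by lia.
  have M1 : u' i s <= u' i t by apply: mono => //; lia.
  have B1 := Ubd i t HT Hi; rewrite En in B1.
  have P : N i s <= N' i.+1 s by apply: P4 => //; lia.
  have Q : N' i.+1 s + u' i.+1 s = N i.+1 s + u' i s by apply: Cons => //; lia.
  have K : u' i.+1 s + C n = C j.+1.
    by apply: IH => //; [lia|lia|exact: th_down].
  have S1 : N i s + C (j.+1 - i) = N0 i s + C i.-1.
    apply: IN => //; [lia|by move=> _; apply: th_le|move=> Hi1].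
    have := th_up i.-1; rewrite prednK //; apply; lia.
  have S2 : N i.+1 s + C (j - i) = N0 i.+1 s + C i.
    have := IN i.+1 s HsT; rewrite subSS; apply; first lia.
      move=> Hi1; apply: leq_trans (th_down i Hij).
      by apply: th_le; lia.
    by move=> _; apply: th_le.
  have D : N0 i s = N0 i.+1 s + c i.
    by apply: (Heq i (j.+1 - i) _ HsT); lia.
  have Ci : C i = C i.-1 + c i by rewrite -{1 3}(prednK Hi0) HC.
  have En' : j - i = n by lia.
  by move: S1 S2; rewrite En En'; lia.
split.
- split=> [t HT|[|i] t HT Hi]; first by rewrite Z.
    by rewrite !Z //; lia.
  by apply: mono => //; lia.
- move=> i t HT Hi; have := P4 i t HT Hi; have := Cons i t HT; lia.
- split=> [i t HT Hi|t HT].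
    have := Cons i t HT; rewrite !Z //; try lia.
    by rewrite I2 //; lia.
  have := Cons j.+2 t HT jb; rewrite /= [u' j.+2 t]Z ?ltnSn ?orbT //.
  by rewrite I2 // ?ltnSn //; lia.
- by move=> i t HT Hi; split; [exact: Ubd|exact: Usat].
- move=> i t HT Hi Ht1 Ht2.
  have Q : N' i t + u' i t = N i t + u' i.-1 t by apply: Cons => //; lia.
  have S1 : u' i.-1 t + C (j.+2 - i) = C j.+1.
    have -> : j.+2 - i = j.+1 - i.-1 by lia.
    case: (ltnP 1 i) => Hi1; last first.
      have -> : i = 1 by lia.
      by rewrite Z // subn0.
    by apply: Usat; [|lia|exact: Ht2].
  case: (ltnP j.+1 i) => Hij.
    have Ei : i = j.+2 by lia.
    move: Q S1; rewrite Ei Z ?ltnSn ?orbT // I2 //; last by rewrite ltnSn.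
    by rewrite subnn C0 /=; lia.
  have S2 : u' i t + C (j.+1 - i) = C j.+1 by apply: Usat => //; exact: Ht1.
  have S3 : N i t + C (j.+1 - i) = N0 i t + C i.-1.
    apply: IN => //; first lia.
      move=> Hi1; apply: leq_trans (Ht1 Hij); apply: th_le; lia.
    move=> Hi1; apply: leq_trans (Ht1 Hij).
    by have := th_up i.-1; rewrite prednK; [apply|]; lia.
  by lia.
Qed.

Lemma rect_inv_final b T m N0 C c e Ns :
  (forall i, C i.+1 = C i + c i.+1) -> C 0 = 0 ->
  (forall i, 0 < i -> i.+1 < b -> e i <= e i.+1 <= e i + m) ->
  (forall i q, 0 < i < b -> e i + m * q <= T ->
     N0 i (e i + m * q) = N0 i.+1 (e i + m * q) + c i) ->
  (forall i t, t <= T -> 0 < i < b -> N0 i t <= N0 i.+1 t + c i) ->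
  (forall i, 0 < i < b -> e i + m * (b.-1 - i) <= T) ->
  Ns 0 = N0 -> (forall j, j < b -> exists u, raises b T j (Ns j) (Ns j.+1) u) ->
  forall i, 0 < i <= b -> Ns b i T + C (b - i) = N0 i T + C i.-1.
Proof.
move=> HC C0 He Heq Hle HT E0 HR i Hi.
(* Phase 0 moves no entry to another row, so the row contents remain [N0]. *)
have inv j : j < b -> exists u, rect_inv b T m N0 C e j (Ns j.+1) u.
  elim: j => [|j IH] Hj; have [u Hu] := HR _ Hj; exists u.
    have [Z Cons _ _ _] := Hu; rewrite E0 in Cons.
    have NE i' t : t <= T -> 0 < i' <= b -> Ns 1 i' t = N0 i' t.
      by move=> Ht Hi'; have := Cons i' t Ht Hi'; rewrite !Z //; lia.
    split.
    - split=> [t Ht|[|i'] t Ht //]; first by rewrite Z.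
      by rewrite !Z // ltnW.
    - by move=> i' t; lia.
    - split=> [i' t Ht Hi'|t Ht]; first by apply: NE => //; lia.
      by rewrite NE // Z // addn0.
    - by move=> [|i'] t Ht // _; rewrite Z.
    - move=> [|[|i']] t Ht // _ _ _; by rewrite NE.
  have [u' Hu'] := IH (ltnW Hj).
  exact: (rect_inv_step HC C0 He Heq Hle Hj Hu' Hu).
have Eb : b = b.-1.+1 by lia.
have [u [_ _ _ _ IN]] := inv b.-1 (ltac:(lia)).
move: IN; rewrite -Eb; apply => //.
- by move=> Hib; rewrite /sat_time; apply: HT; lia.
- move=> Hi1; rewrite /sat_time; apply: HT; lia.
Qed.

(** * From horizontal strips to the recursion *)

Definition row_content (b : nat) (s : nat -> nat -> nat) (i t : nat) :=
  s t (b - i) - s 0 (b - i).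

Lemma growth_mono M s y x p : growth M s y -> x <= M -> s 0 p <= s x p.
Proof.
move=> [_ Hy]; elim: x => [//|x IH] Hx; rewrite Hy //.
by have := IH (ltnW Hx); lia.
Qed.

(** In the rows concerned the inner cells are gone, so interlacing of shapes becomes an inequality
    between row contents, and the local rule says that entries move only when it is tight. *)
Lemma strip_raises b M j s y t yt :
  j < b -> growth M s y -> growth M t yt ->
  strip M (b - j.+1) s y t yt ->
  (forall x, x < M -> y x < b) ->
  (forall p, b - j.+1 < p -> s 0 p = 0) ->
  (forall p, b - j.+1 <= p -> t 0 p = 0) ->
  exists u, raises b M j (row_content b s) (row_content b t) u.
Proof.
move=> Hj Gs Gt [Hle Hint Hrule] Hb S0 T0.
have [_ Hy] := Gs; have [_ Hyt] := Gt.
pose mv x := (b - j.+1 < y x) && (s x (y x) == t x (y x).-1).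
have {}Hrule x : x < M -> yt x = if mv x then (y x).-1 else y x by exact: Hrule.
exists (fun i x => \sum_(x' < x) (mv x' && (y x' == b - i))); split.
- move=> i x Hx Hi; rewrite big1 // => x' _.
  have /Hb : x' < M by exact: leq_trans (ltn_ord x') Hx.
  by rewrite /mv; case: (eqVneq (y x') (b - i)) => [->|]; lia.
- move=> i x Hx Hi; rewrite /row_content; elim: x Hx => [|x IH] Hx.
    by rewrite !big_ord0; lia.
  have := IH (ltnW Hx); rewrite !big_ord_recr /= Hy // Hyt // Hrule //.
  have := growth_mono (b - i) Gs (ltnW Hx).
  have := growth_mono (b - i) Gt (ltnW Hx).
  have Em : mv x -> 0 < y x by rewrite /mv; lia.
  have -> : b - i.-1 = (b - i).+1 by lia.
  by case: (mv x) Em => /=; lia.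
- by move=> i; rewrite big_ord0.
- move=> i x Hx Hi; rewrite /row_content S0; last by lia.
  rewrite T0; last by lia.
  have -> : b - i = (b - i.+1).+1 by lia.
  by rewrite !subn0; apply: Hint.
- move=> i x Hx Hi; rewrite big_ord_recr /=.
  case: (boolP (mv x && _)) => [/andP[Hm /eqP E]|_]; last by left; rewrite addn0.
  right; split; first by lia.
  have := Hm; rewrite /mv E => /andP[_ /eqP Es].
  rewrite /row_content S0; last by lia.
  rewrite T0; last by lia.
  rewrite Hy // Hyt // Hrule // Hm E Es.
  have -> : b - i.+1 = (b - i).-1 by lia.
  by rewrite !eqxx.
Qed.

(** * First rows of insertion tableaux *)

Definition cnt (t : nat) (l : seq nat) := count (fun x => x <= t) l.

Lemma cnt_le t t' l : t <= t' -> cnt t l <= cnt t' l.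
Proof. by move=> H; apply: sub_count => x /leq_trans; apply. Qed.

Lemma cnt_all t l : all (fun x => x <= t) l -> cnt t l = size l.
Proof. by rewrite all_count => /eqP. Qed.

Lemma cnt_none t l : all (fun x => t < x) l -> cnt t l = 0.
Proof.
move=> H; apply/eqP; rewrite -leqn0 leqNgt -has_count; apply/hasPn => x /(allP H).
by rewrite -ltnNge.
Qed.

Lemma cnt_gt t l : cnt t l + count (fun x => t < x) l = size l.
Proof.
by rewrite -(count_predC (fun x => x <= t) l); congr addn; apply: eq_count => x /=; lia.
Qed.

Lemma cntS x l : cnt x.+1 l = cnt x l + count_mem x.+1 l.
Proof. by rewrite /cnt; elim: l => //= a l ->; lia. Qed.

Lemma sorted_cnt l d x :
  sorted ltn l -> d < size l -> (nth 0 l d <= x) = (d < cnt x l).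
Proof.
rewrite /cnt; elim: l d => [//|a l IH] d Hs Hd /=.
have Ha : all (ltn a) l by apply: order_path_min Hs; exact: ltn_trans.
have Hl : sorted ltn l by apply: path_sorted Hs.
case: (leqP a x) => Hax; case: d Hd => [|d] Hd //=; first by rewrite IH.
  have : cnt x l = 0 by apply: cnt_none; apply: sub_all Ha => z /= ; lia.
  by rewrite /cnt => ->; lia.
have -> : count (fun x0 => x0 <= x) l = 0.
  by apply: cnt_none; apply: sub_all Ha => z /= ; lia.
have := all_nthP 0 Ha d Hd; rewrite /=; lia.
Qed.

Definition insert_row (Q : seq nat) (x : nat) := (Defs.bump Q x).2.

Lemma head_rs_insert P us :
  head [::] (foldl rs_insert P us) = foldl insert_row (head [::] P) us.
Proof.
elim: us P => [//|u us IH] P /=; rewrite IH; congr foldl.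
case: P => [|Q P] //=; rewrite /insert_row /Defs.bump.
by case: ifP.
Qed.

Lemma insert_row_max Q x :
  all (fun y => y < x) Q -> insert_row Q x = rcons Q x.
Proof.
move=> H; rewrite /insert_row /Defs.bump -has_find ifN //.
by apply/hasPn => y /(allP H); rewrite -leqNgt => /ltnW.
Qed.

Lemma foldl_insert_sorted Q us :
  sorted ltn (Q ++ us) -> foldl insert_row Q us = Q ++ us.
Proof.
elim: us Q => [|u us IH] Q; first by rewrite cats0.
move=> Hs; rewrite /= insert_row_max; first by rewrite IH cat_rcons.
move: Hs; rewrite (sorted_pairwise ltn_trans) pairwise_cat allrel_consr.
by case/andP=> /andP[H _] _; apply: sub_all H => z.
Qed.

(* [g t] says that the bumped entry, if any, is at most [t]. *)
Lemma insert_row_cnt Q u :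
  sorted ltn Q -> u \notin Q ->
  exists g : nat -> bool,
  [/\ forall t, cnt t (insert_row Q u) + g t = cnt t Q + (u <= t),
      forall t, g t -> u < t,
      forall t, ~~ g t -> u <= t.+1 -> cnt t Q = cnt u.-1 Q &
      sorted ltn (insert_row Q u) /\ {subset insert_row Q u <= u :: Q}].
Proof.
rewrite (sorted_pairwise ltn_trans) => Hs Hu.
case: (boolP (has (fun y => u < y) Q)) => [Hh|Hn]; last first.
  have Ha : all (fun y => y < u) Q.
    apply/allP => y Hy; move/hasPn: Hn => /(_ _ Hy); rewrite -leqNgt leq_eqVlt.
    by case/orP=> // /eqP Ey; rewrite -Ey Hy in Hu.
  exists (fun=> false); rewrite insert_row_max //; split=> //.
  - by move=> t; rewrite /cnt -cats1 count_cat /= !addn0.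
  - move=> t _ Ht; rewrite !cnt_all //; apply: sub_all Ha => z; lia.
  - rewrite (sorted_pairwise ltn_trans) -cats1 pairwise_cat Hs andbT allrel_consr.
    rewrite allrel0r !andbT; split; first exact: Ha.
    by move=> z; rewrite mem_cat !inE orbC.
have := Hh; rewrite has_find => Hf; have Hn := nth_find 0 Hh.
set p := find _ _ in Hf Hn.
have EQ : Q = take p Q ++ nth 0 Q p :: drop p.+1 Q.
  by rewrite -drop_nth // cat_take_drop.
have EQ' : insert_row Q u = take p Q ++ u :: drop p.+1 Q.
  by rewrite /insert_row /Defs.bump -/p Hf /= set_nthE Hf.
move: Hn EQ EQ'; set y := nth 0 Q p; set A := take p Q; set B := drop p.+1 Q.
move=> /= Hy EQ ->.
have HA : all (fun z => z < u) A.
  apply/allP => z Hz; have Hz' : z \in Q by rewrite EQ mem_cat Hz.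
  have : index z A < p by rewrite -(size_takel (ltnW Hf)) index_mem.
  move=> Hi; have := before_find 0 Hi.
  rewrite -(nth_take 0 Hi) -/A nth_index // => /negbT; rewrite -leqNgt leq_eqVlt.
  by case/orP=> // /eqP Ez; rewrite -Ez Hz' in Hu.
move: Hs; rewrite EQ pairwise_cat /= => /and3P[H1 H2 /andP[H3 H4]].
exists (fun t => y <= t); split.
- by move=> t; rewrite /cnt !count_cat /=; lia.
- by move=> t; lia.
- move=> t; rewrite -ltnNge => Hyt Hut; rewrite /cnt !count_cat /=.
  have HB t' : t' < y -> count (fun x => x <= t') B = 0.
    by move=> Ht'; apply: cnt_none; apply: sub_all H3 => z /=; lia.
  have HA' t' : u <= t'.+1 -> count (fun x => x <= t') A = size A.
    by move=> Ht'; apply: cnt_all; apply: sub_all HA => z /=; lia.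
  by rewrite !HB ?HA'; lia.
- rewrite (sorted_pairwise ltn_trans) pairwise_cat /= H2 H4 !allrel_consr.
  move: H1; rewrite allrel_consr => /andP[_ ->]; rewrite !andbT.
  split; first by rewrite HA /=; apply: sub_all H3 => z /=; lia.
  by move=> z; rewrite !(mem_cat, inE) => /or3P[->|->|->]; rewrite ?orbT.
Qed.

(** Schensted's theorem for two increasing words: a longest increasing subsequence takes the letters
    up to some [t] from [Q] and the larger ones from [us]. *)
Lemma size_foldl_insert m Q us :
  sorted ltn Q -> sorted ltn us -> all (fun u => (u \notin Q) && (0 < u <= m)) us ->
  all (fun x => x <= m) Q ->
  let F := size (foldl insert_row Q us) in
  (forall t, cnt t Q + count (fun x => t < x) us <= F) /\
  exists2 t, t <= m & cnt t Q + count (fun x => t < x) us = F.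
Proof.
elim: us Q => [|u us IH] Q HQ Hus Hall Hm /=.
  split=> [t|]; first by rewrite addn0 count_size.
  by exists m => //; rewrite addn0 cnt_all.
move: Hall => /= /andP[/andP[HuQ /andP[Hu0 Hum]] Hall].
have [g [Hg Hgu Hflat [HQ' Hsub]]] := insert_row_cnt HQ HuQ.
have Hgt : all (fun z => u < z) us by apply: order_path_min Hus; exact: ltn_trans.
have [||H1 [t' Ht' E]] := IH (insert_row Q u) HQ' (path_sorted Hus).
- apply/allP => z Hz; have /andP[HzQ ->] := allP Hall z Hz; rewrite andbT.
  apply: contra HzQ => /Hsub; rewrite inE => /orP[/eqP Ez|//].
  by have := allP Hgt z Hz; rewrite Ez ltnn.
- by apply/allP => z /Hsub; rewrite inE => /orP[/eqP->//|/(allP Hm)].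
set F := size _ in H1 E *.
have Hcu t : t <= u -> count (fun x => t < x) us = size us.
  by move=> Htu; apply/eqP; rewrite -all_count; apply: sub_all Hgt => z; lia.
have Hng t : t <= u -> g t = false by move=> Htu; apply/negP => /Hgu; lia.
have C1 t : cnt t Q + ((t < u) + count (fun x => t < x) us) <= F.
  case: (ltnP t u) => Htu; last by have := Hg t; have := H1 t; lia.
  have := H1 u; have := Hg u; rewrite Hng // (Hcu u) // (Hcu t (ltnW Htu)).
  have -> : cnt u Q = cnt u.-1 Q by apply: Hflat => //; rewrite Hng.
  by have := @cnt_le t u.-1 Q; lia.
split=> //; have := Hg t'; case: (ltnP t' u) => Htu.
  by rewrite Hng 1?ltnW //; have := C1 t'; lia.
case: (boolP (g t')) => Hgt' Ht; first by exists t' => //; lia.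
(* No entry of [Q] lies between [u] and [t'], so switching just before [u] loses nothing from [Q]
   and takes all of [u :: us]. *)
exists u.-1; first by lia.
have := C1 u.-1; have := Hflat t' Hgt' (leqW Htu); rewrite Hcu; last by lia.
by have := count_size (fun x => t' < x) us; lia.
Qed.

(** As [U] has [r] letters, subtracting [r] turns the maximum in [size_foldl_insert] into the
    maximum of [cnt t R - cnt t U]. *)
Lemma first_row_excess m r R U :
  sorted ltn R -> sorted ltn U -> size R = r -> size U = r ->
  all (fun u => u \notin R) U -> all (fun x => 0 < x <= m) (R ++ U) ->
  let c := first_row_length (RS_P (R ++ U)) - r in
  (forall t, cnt t R <= cnt t U + c) /\
  exists2 t, t <= m & cnt t R = cnt t U + c.
Proof.
move=> HR HU SR SU Hd; rewrite all_cat => /andP[HmR HmU] /=.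
rewrite /first_row_length /RS_P foldl_cat head_rs_insert.
rewrite head_rs_insert /= (@foldl_insert_sorted [::] R) //=.
have [||H1 [t Ht E]] := @size_foldl_insert m R U HR HU.
- by apply/allP => z Hz; rewrite (allP Hd) // (allP HmU).
- by apply: sub_all HmR => z /andP[].
(* At [t = m] the first row is seen to have length at least [r], so the truncated subtraction in [c]
   is exact. *)
have Fr := H1 m; rewrite cnt_all in Fr; last by apply: sub_all HmR => z /andP[].
have G t' := cnt_gt t' U.
split=> [t'|]; first by have := H1 t'; have := G t'; lia.
by exists t => //; have := G t; lia.
Qed.

(** * Counts and shape chain of the power tableau *)

Definition power_row (m : nat) (row : seq nat) (k : nat) :=
  flatten [seq [seq x + q * m | x <- row] | q <- iota 0 k].

Lemma power_rowS m row k :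
  power_row m row k.+1 = power_row m row k ++ [seq x + k * m | x <- row].
Proof. by rewrite /power_row -addn1 iotaD map_cat flatten_cat /= cats0. Qed.

Lemma power_row_bound m row k :
  all (fun x => 0 < x <= m) row -> all (fun x => 0 < x <= k * m) (power_row m row k).
Proof.
move=> H; elim: k => [//|k IH]; rewrite power_rowS all_cat all_map.
apply/andP; split; first by apply: sub_all IH => x; rewrite mulSn; lia.
by apply: sub_all H => x /=; rewrite mulSn; lia.
Qed.

Lemma power_row_sorted m row k :
  all (fun x => 0 < x <= m) row -> sorted ltn row -> sorted ltn (power_row m row k).
Proof.
move=> H Hs; elim: k => [//|k IH]; rewrite power_rowS.
move: IH Hs; rewrite !(sorted_pairwise ltn_trans) pairwise_cat => -> Hs /=.
rewrite pairwise_map; apply/andP; split; last first.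
  by apply: sub_pairwise Hs => x y /=; rewrite ltn_add2r.
apply/allrelP => x y /(allP (power_row_bound k H)) /andP[_ Hx] /mapP[z /(allP H) Hz ->].
by rewrite /=; lia.
Qed.

Lemma size_power_row m row k : size (power_row m row k) = k * size row.
Proof.
by elim: k => [//|k IH]; rewrite power_rowS size_cat IH size_map mulSn addnC.
Qed.

Lemma cnt_power_row m row k q s :
  0 < m -> all (fun x => 0 < x <= m) row -> s <= m -> q * m + s <= k * m ->
  cnt (q * m + s) (power_row m row k) = q * size row + cnt s row.
Proof.
(* The case [s = 0] is separate because it alone allows [q = k]. *)
move=> Hm H Hs; case: (posnP s) => [->|Hs0] Hq.
  rewrite addn0 (@cnt_none 0) ?addn0; last by apply: sub_all H => x /andP[].
  have Hqk : q <= k by rewrite -(leq_pmul2r Hm) -[q * m]addn0; lia.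
  elim: k Hqk {Hq} => [|k IH].
    by rewrite leqn0 => /eqP->.
  rewrite power_rowS /cnt count_cat -/(cnt _ _) count_map leq_eqVlt.
  case/orP=> [/eqP->|Hqk].
    have -> : count (preim (fun x => x + k * m) (fun x => x <= k.+1 * m)) row
            = size row.
      by apply/eqP; rewrite -all_count; apply: sub_all H => x /=; rewrite mulSn; lia.
    rewrite cnt_all ?size_power_row ?mulSn 1?addnC //.
    by apply: sub_all (power_row_bound k H) => x; lia.
  rewrite IH // (eq_in_count (a2 := pred0)) ?count_pred0 ?addn0 // => x /(allP H) /=.
  by have := leq_mul2r m q k; lia.
have Hqk : q < k by rewrite -(ltn_pmul2r Hm); lia.
elim: k Hqk {Hq} => [//|k IH]; rewrite ltnS leq_eqVlt.
rewrite power_rowS /cnt count_cat -/(cnt _ _) count_map.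
case/orP=> [/eqP->|Hqk].
  rewrite cnt_all ?size_power_row; last first.
    by apply: sub_all (power_row_bound k H) => x; lia.
  by congr addn; apply: eq_count => x /=; lia.
rewrite IH // (eq_in_count (a2 := pred0)) ?count_pred0 ?addn0 // => x /(allP H) /=.
by have := leq_mul2r m q.+1 k; rewrite mulSn; lia.
Qed.

Definition letter_row (rows : seq (seq nat)) (x : nat) :=
  index 1 [seq count_mem x.+1 row | row <- rows].

Lemma sumn_eq1 l :
  sumn l = 1 -> index 1 l < size l /\ forall p, nth 0 l p = (p == index 1 l).
Proof.
elim: l => [//|a l IH] /=; case: a => [|[|a]] //= H.
  by have [H1 H2] := IH H; split=> // -[|p] //=; rewrite H2.
split=> // -[|p] //=; have : sumn l = 0 by case: H.
by elim: l p {H IH} => [|b l IH] [|p] //= H; [lia|apply: IH; lia].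
Qed.

Lemma letter_rowP rows m x :
  perm_eq (flatten rows) (iota 1 m) -> x < m ->
  letter_row rows x < size rows /\
  forall p, count_mem x.+1 (nth [::] rows p) = (p == letter_row rows x).
Proof.
move=> Hp Hx; have : sumn [seq count_mem x.+1 row | row <- rows] = 1.
  rewrite -count_flatten (permP Hp) count_uniq_mem ?iota_uniq //.
  by rewrite mem_iota; have -> : 1 <= x.+1 < 1 + m by lia.
move=> /sumn_eq1 [H1 H2]; rewrite size_map in H1; split=> // p.
rewrite -H2; case: (ltnP p (size rows)) => H; first by rewrite (nth_map [::]).
by rewrite !nth_default // size_map.
Qed.

Lemma nth_all (P : pred nat) rows p :
  (forall row, row \in rows -> all P row) -> all P (nth [::] rows p).
Proof.
move=> H; case: (ltnP p (size rows)) => Hp; last by rewrite nth_default.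
by apply: H; apply: mem_nth.
Qed.

(** Otherwise the first cell of row [p] with an entry above [s] would have an entry at most [s]
    below it, against column strictness; equal row lengths ensure that this cell exists. *)
Lemma standard_column mu rows s p :
  standard_skew mu rows -> (exists r, all (fun row => size row == r) rows) ->
  nth 0 mu p.+1 + cnt s (nth [::] rows p.+1) <=
  nth 0 mu p + cnt s (nth [::] rows p).
Proof.
move=> [[Smu Hmu _] Hp Hs Hcol] [r /allP Hr].
case: (ltnP p.+1 (size rows)) => Hp1; last first.
  by rewrite [nth 0 mu _]nth_default ?Smu // [nth _ _ p.+1]nth_default.
have Hmup : nth 0 mu p.+1 <= nth 0 mu p.
  by have /sortedP := Hmu => /(_ 0 p); apply; rewrite Smu.
have sz q : q < size rows -> size (nth [::] rows q) = r.
  by move=> Hq; apply/eqP/Hr/mem_nth.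
have pos q d : d < size (nth [::] rows q) -> 0 < nth 0 (nth [::] rows q) d.
  move=> Hd; case: (ltnP q (size rows)) => Hq; last by rewrite nth_default in Hd.
  have : nth 0 (nth [::] rows q) d \in flatten rows.
    by apply/flattenP; exists (nth [::] rows q); apply: mem_nth.
  by rewrite (perm_mem Hp) mem_iota => /andP[].
have st q : sorted ltn (nth [::] rows q).
  case: (ltnP q (size rows)) => Hq; last by rewrite nth_default.
  by apply: (allP Hs); apply: mem_nth.
rewrite leqNgt; apply/negP => Hlt.
set c := nth 0 mu p + cnt s (nth [::] rows p) in Hlt.
have Hc1 := count_size (fun x => x <= s) (nth [::] rows p.+1).
rewrite -/(cnt _ _) (sz p.+1) // in Hc1.
have Sp := sz p (ltnW Hp1); have Sp1 := sz p.+1 Hp1.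
have E0 : tab_fun mu rows p c = nth 0 (nth [::] rows p) (c - nth 0 mu p).
  by rewrite /tab_fun Sp ifT //; lia.
have E1 : tab_fun mu rows p.+1 c = nth 0 (nth [::] rows p.+1) (c - nth 0 mu p.+1).
  by rewrite /tab_fun Sp1 ifT //; lia.
have P0 := pos p (c - nth 0 mu p); have P1 := pos p.+1 (c - nth 0 mu p.+1).
have := Hcol p c; rewrite E0 E1 -!lt0n P0 ?P1 ?Sp ?Sp1; try lia.
move=> /(_ isT isT).
have := @sorted_cnt _ (c - nth 0 mu p) s (st p).
have := @sorted_cnt _ (c - nth 0 mu p.+1) s (st p.+1).
by rewrite Sp Sp1; lia.
Qed.

Lemma fills_tab_fun M mu R :
  (forall p, sorted ltn (nth [::] R p)) ->
  (forall p, all (fun x => 0 < x <= M) (nth [::] R p)) ->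
  fills M (fun x p => nth 0 mu p + cnt x (nth [::] R p)) (tab_fun mu R).
Proof.
move=> Hs Hb; split=> [i c|i c x Hx]; rewrite /tab_fun; case: ifP => // Hc.
- have Hd : c - nth 0 mu i < size (nth [::] R i) by lia.
  by have /(allP (Hb i)) /andP[] := mem_nth 0 Hd.
- have := @sorted_cnt _ (c - nth 0 mu i) x (Hs i).
  have := @sorted_cnt _ (c - nth 0 mu i) x.+1 (Hs i); lia.
- have := count_size (fun z => z <= x.+1) (nth [::] R i).
  by rewrite -/(cnt _ _); lia.
Qed.

Lemma nth_power_rows rows k p :
  nth [::] (power_rows rows k) p =
  power_row (size (flatten rows)) (nth [::] rows p) k.
Proof.
case: (ltnP p (size rows)) => Hp; first by rewrite (nth_map [::]).
rewrite !nth_default ?size_map //; apply/esym/size0nil.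
by rewrite size_power_row muln0.
Qed.

(** * The shape of the rectification *)

Lemma phases_raises M mu g t j :
  growth M g.1 g.2 -> fills M g.1 t -> (forall p, g.1 0 p = nth 0 mu p) ->
  (forall x, x < M -> g.2 x < size mu) -> j <= size mu ->
  (forall x, x < M -> (phases mu g j).2 x < size mu) /\
  forall i, i < j ->
    exists u, raises (size mu) M i (row_content (size mu) (phases mu g i).1)
                     (row_content (size mu) (phases mu g i.+1).1) u.
Proof.
move=> G F E Hy; elim: j => [//|j IH] Hj.
have [Yj Uj] := IH (ltnW Hj).
have [Gj Ej _ _] := rect_aux_phases G F E (ltnW Hj).
have [Gj1 Ej1 /(_ j erefl) Sj _] := rect_aux_phases G F E Hj.
have zero i p : i <= size mu -> size mu - i <= p ->
    nth 0 (take (size mu - i) mu ++ nseq i 0) p = 0.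
  move=> Hi Hp; rewrite nth_cat size_take ltnNge.
  have -> : (if size mu - i < size mu then size mu - i else size mu) = size mu - i.
    by case: ifP; lia.
  by rewrite Hp nth_nseq; case: ifP.
split.
  move=> x Hx; have [_ _ /(_ x Hx) ->] := Sj.
  by have := Yj x Hx; case: ifP; lia.
move=> i; rewrite ltnS leq_eqVlt => /orP[/eqP->|]; last exact: Uj.
apply: (strip_raises Hj Gj Gj1 Sj Yj).
- by move=> p Hp; rewrite Ej zero //; lia.
- by move=> p Hp; rewrite Ej1 zero.
Qed.

Lemma size_flatten_power_row m rows k :
  size (flatten [seq power_row m row k | row <- rows]) = k * size (flatten rows).
Proof.
elim: rows => [|row rows IH] /=; first by rewrite muln0.
by rewrite !size_cat IH size_power_row mulnDr.
Qed.

Lemma rect_power_rows b r k mu rows :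
  0 < b -> 0 < r -> size rows = b -> all (fun row => size row == r) rows ->
  standard_skew mu rows -> b.-1 <= k ->
  let w i := nth [::] rows (b - i) in
  let c i := first_row_length (RS_P (w i ++ w i.+1)) - r in
  let C j := \sum_(1 <= i < j.+1) c i in
  exists L : nat -> nat,
    (forall p, p < b -> L p + C p = k * r + C (b - p.+1)) /\
    forall i col, (Rect mu (power_rows rows k) i col != 0) = (i < b) && (col < L i).
Proof.
move=> Hb Hr Srows Hall Hstd Hk w c C.
have [[Smu _ _] Hperm Hsort _] := Hstd.
set m := size (flatten rows) in Hperm.
have sz p : p < b -> size (nth [::] rows p) = r.
  by move=> Hp; apply/eqP/(allP Hall)/mem_nth; rewrite Srows.
have szle p : size (nth [::] rows p.+1) <= size (nth [::] rows p).
  case: (ltnP p.+1 b) => Hp; first by rewrite !sz // ltnW.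
  by rewrite [nth _ _ p.+1]nth_default // Srows.
have Hm : 0 < m.
  have : nth 0 (nth [::] rows 0) 0 \in flatten rows.
    by apply/flattenP; exists (nth [::] rows 0); apply: mem_nth; rewrite ?Srows ?sz.
  by rewrite /m; case: (flatten rows).
have Hbd p : all (fun x => 0 < x <= m) (nth [::] rows p).
  apply: nth_all => row Hrow; apply/allP => x Hx.
  have : x \in flatten rows by apply/flattenP; exists row.
  by rewrite (perm_mem Hperm) mem_iota; lia.
have Hst p : sorted ltn (nth [::] rows p).
  case: (ltnP p (size rows)) => Hp; last by rewrite nth_default.
  by apply/(allP Hsort)/mem_nth.
have cntR p q s : s <= m -> q * m + s <= k * m ->
    cnt (q * m + s) (nth [::] (power_rows rows k) p)
    = q * size (nth [::] rows p) + cnt s (nth [::] rows p).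
  by move=> Hs Hq; rewrite nth_power_rows cnt_power_row.
set M := k * m.
have HM : size (flatten (power_rows rows k)) = M.
  exact: size_flatten_power_row.
pose g := (fun x p => nth 0 mu p + cnt x (nth [::] (power_rows rows k) p),
           fun x => letter_row rows (x %% m)).
have letter x := letter_rowP Hperm (ltn_pmod x Hm).
(* After [q] copies and [s] further entries, the shape is that of S at [s] with each row lengthened
   by [q] times its size, so [standard_column] carries over. *)
have G : growth M g.1 g.2.
  split=> [x p Hx|x p Hx] /=; rewrite (divn_eq x m) in Hx *.
    have Hs := ltnW (ltn_pmod x Hm); rewrite !cntR //.
    have := standard_column (x %% m) p Hstd (ex_intro _ r Hall).
    have := leq_mul2l (x %/ m) (size (nth [::] rows p.+1)) (size (nth [::] rows p)).
    by rewrite szle orbT; lia.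
  have Hs := ltn_pmod x Hm; rewrite modnMDl modn_mod -addnS !cntR //; try lia.
  by rewrite cntS; have [_ ->] := letter x; lia.
have F : fills M g.1 (tab_fun mu (power_rows rows k)).
  by apply: fills_tab_fun => p; rewrite nth_power_rows;
    [exact: power_row_sorted|exact: power_row_bound].
have E0 p : g.1 0 p = nth 0 mu p.
  by rewrite /= (cntR p 0 0) // cnt_none ?addn0 //; apply: sub_all (Hbd p) => x /andP[].
have Hy x : x < M -> g.2 x < size mu.
  by move=> _; rewrite Smu; have [] := letter x.
have Smub : size mu = b by rewrite Smu.
have [Yb Ub] := phases_raises G F E0 Hy (leqnn _).
have [Gb Eb _ [tb Fb Rb]] := rect_aux_phases G F E0 (leqnn _).
rewrite Smub subnn take0 /= sumn_nseq mul0n /= in Eb Rb Gb Fb Yb Ub.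
have Eb' p : (phases mu g b).1 0 p = 0 by rewrite Eb nth_nseq; case: ifP.
pose N0 := row_content b g.1.
have N0E i q s : s <= m -> q * m + s <= M -> 0 < i <= b ->
    N0 i (q * m + s) = q * r + cnt s (w i).
  move=> Hs Hq Hi; rewrite /N0 /row_content E0 /= cntR // sz; last by lia.
  by rewrite addKn.
have cP i : 0 < i < b ->
    (forall t, cnt t (w i) <= cnt t (w i.+1) + c i) /\
    exists2 t, t <= m & cnt t (w i) = cnt t (w i.+1) + c i.
  move=> Hi; apply: first_row_excess; try exact: Hst; try by apply: sz; lia.
    apply/allP => u Hu; apply/negP => Hu'.
    have u0 : u = u.-1.+1 by have /andP[] := allP (Hbd _) u Hu; lia.
    have um : u.-1 < m by have /andP[] := allP (Hbd _) u Hu; lia.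
    have [_ L] := letter_rowP Hperm um; rewrite -u0 in L.
    have A1 : 0 < count_mem u (nth [::] rows (b - i.+1)).
      by rewrite -has_count has_pred1.
    have A2 : 0 < count_mem u (nth [::] rows (b - i)) by rewrite -has_count has_pred1.
    by rewrite !L in A1 A2; lia.
  by rewrite all_cat !Hbd.
pose pk i := find (fun t => cnt t (w i) == cnt t (w i.+1) + c i) (iota 0 m.+1).
have pkP i : 0 < i < b ->
    pk i <= m /\ cnt (pk i) (w i) = cnt (pk i) (w i.+1) + c i.
  move=> /cP [_ [t Ht Et]].
  have Hh : has (fun t => cnt t (w i) == cnt t (w i.+1) + c i) (iota 0 m.+1).
    by apply/hasP; exists t; [rewrite mem_iota; lia|apply/eqP].
  have := nth_find 0 Hh; have := Hh; rewrite has_find size_iota -/(pk i) => Hp.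
  by rewrite nth_iota // add0n => /eqP.
(* [e i] is the first place where D_i = c_i, shifted by enough copies of S to make
   [e] increase; one extra copy is needed at each descent of [pk]. *)
pose X i := \sum_(2 <= l < i.+1) (pk l < pk l.-1).
have XS i : 0 < i -> X i.+1 = X i + (pk i.+1 < pk i).
  by move=> Hi; rewrite /X big_nat_recr.
have Xle i : 0 < i -> X i <= i.-1.
  elim: i => [//|[|i] IH] _; first by rewrite /X big_geq.
  by rewrite XS //; have := IH isT; lia.
pose e i := pk i + m * X i.
have CS i : C i.+1 = C i + c i.+1 by rewrite /C big_nat_recr.
have C00 : C 0 = 0 by rewrite /C big_geq.
have fin := @rect_inv_final b M m N0 C c e
  (fun j => row_content b (phases mu g j).1) CS C00.
exists (fun p => (phases mu g b).1 M p); split=> [p Hp|i col].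
  have : row_content b (phases mu g b).1 (b - p) M + C (b - (b - p))
       = N0 (b - p) M + C (b - p).-1.
    apply: fin => //; last by lia.
    - move=> i Hi Hib; rewrite /e XS // mulnDr.
      have [H1 _] := pkP i (ltac:(lia)); have [H2 _] := pkP i.+1 (ltac:(lia)).
      by case: (ltnP (pk i.+1) (pk i)); rewrite ?muln1 ?muln0; lia.
    (* These times are congruent to [pk i] modulo [m], and the complete copies contribute equally to
       both rows. *)
    - move=> i q Hi; have [H1 H2] := pkP i Hi.
      rewrite /e -addnA -mulnDr addnC mulnC => Hq.
      by rewrite !N0E //; lia.
    - move=> i t Ht Hi; have [H1 _] := cP i Hi; have Hs := ltn_pmod t Hm.
      have := H1 (t %% m); rewrite (divn_eq t m) in Ht *; rewrite modnMDl modn_mod.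
      by rewrite !N0E //; lia.
    (* Here [b.-1] copies suffice: [pk i] costs at most one, the descents at most [i.-1], and the
       delay [b.-1 - i]. *)
    - move=> i Hi; have [H1 _] := pkP i Hi; have := Xle i.
      rewrite /e -addnA -mulnDr => Hx; apply: (@leq_trans (m * b.-1)).
        have -> : b.-1 = (b.-2).+1 by lia.
        by rewrite mulnS leq_add // leq_mul2l; lia.
      by rewrite mulnC leq_mul2r Hk orbT.
  have := N0E (b - p) k 0; rewrite addn0 cnt_none ?addn0; last first.
    by apply: sub_all (Hbd _) => x /andP[].
  move=> -> //; last by lia.
  rewrite /row_content Eb' subn0.
  have -> : b - (b - p) = p by lia.
  by have -> : (b - p).-1 = b - p.+1 by lia.
rewrite /Rect HM Rb (fills_neq0 _ _ Gb Fb) Eb' /=.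
case: (ltnP i b) => Hi //.
(* No entry ever lies in a row with index at least [b]. *)
have : forall x, x <= M -> (phases mu g b).1 x i = 0.
  elim=> [//|x IH] Hx; have [_ Gy] := Gb; rewrite Gy // (IH (ltnW Hx)).
  by have := Yb x Hx; lia.
by move=> ->.
Qed.

Import GRing.Theory Num.Theory.
Local Open Scope ring_scope.

(* rows of S are listed top to bottom: nth [::] rows 0 is the top row.
   w_i (i = 1..b, w_1 bottom) is nth [::] rows (b - i). *)
Theorem theorem1p6 (b r : nat) (mu : seq nat) (rows : seq (seq nat)) :
  (1 <= b)%N -> (1 <= r)%N ->
  size rows = b ->
  all (fun row => size row == r) rows ->
  standard_skew mu rows ->
  let w := fun i : nat => nth [::] rows (b - i) in
  let c := fun i : nat => (first_row_length (RS_P (w i ++ w i.+1)) - r)%N in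
  let lam := fun k j : nat =>
     ((k * r)%N%:Z + \sum_(1 <= i < (b - j).+1) (c i)%:Z
                   - \sum_(1 <= i < j) (c i)%:Z) in
  forall k : nat, (b.-1 <= k)%N ->
    (forall j, (1 <= j <= b)%N -> 0 <= lam k j) /\
    (forall i col : nat,
       (Rect mu (power_rows rows k) i col != 0%N) =
       ((i < b)%N && ((col%:Z) < lam k i.+1))).
Proof.
move=> Hb Hr Srows Hall Hstd w c lam k Hk.
have [L [HL HR]] := rect_power_rows Hb Hr Srows Hall Hstd Hk.
(* Identifying [lam] with the natural number [L p] also gives its nonnegativity. *)
have lamE p : (p < b)%N -> lam k p.+1 = (L p)%:Z.
  move=> Hp.
  have : (L p + \sum_(1 <= i < p.+1) c i
          = k * r + \sum_(1 <= i < (b - p.+1).+1) c i)%N := HL p Hp.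
  by rewrite /lam -!(big_morph Posz PoszD (erefl _)); lia.
split=> [[//|p] /andP[_ Hp]|i col]; first by rewrite lamE.
by rewrite HR; case: (ltnP i b) => //= Hi; rewrite lamE.
Qed.
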